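(* Let $1<p<\infty$ and $\frac1p+\frac1q=1$. The normalized duality mapping $J:l_p\to l_q$ has the following differentiation properties. (i) For $1<p<\infty$, $J$ is Gâteaux differentiable at $\theta$ and $J'(\theta)(v)=J(v)$ for any $v\in l_p\setminus\{\theta\}$. (ii) For $2<p<\infty$, $J$ is Gâteaux differentiable on $l_p\setminus\{\theta\}$. More precisely, let $\bar x=(\bar t_1,\bar t_2,\dots)\in l_p\setminus\{\theta\}$. For any $v=\{s_n\}_{n=1}^\infty\in l_p\setminus\{\theta\}$ with ratio sequence $\{\lambda_n\}_{n=1}^\infty$ with respect to $\bar x$, the Gâteaux derivative of $J$ at $\bar x$ in direction $v$ is $$J'(\bar x)(v)=J(\bar x)\left((p-1)\begin{pmatrix}\lambda_1&0&\cdots\\0&\lambda_2&0\\\vdots&0&\ddots\end{pmatrix}-\frac{(p-2)\sum_{i=1}^\infty\lambda_i|\bar t_i|^p}{\sum_{i=1}^\infty|\bar t_i|^p}\begin{pmatrix}1&0&\cdots\\0&1&0\\\vdots&0&\ddots\end{pmatrix}\right).\qquad( * )$$ In particular: (a) if $|\mathcal N(\bar x)|=1$ with $\bar t_m\neq0$, then $J'(\bar x)(v)=J(\bar x)\Lambda_m=\bar x\,\Lambda_m$, where $\Lambda_m$ is the infinite diagonal matrix whose $m$th diagonal entry is $\lambda_m$ and all of whose other entries are $0$; (b) if $s_n\bar t_n=0$ for all $n=1,2,\dots$, then $J'(\bar x)(v)=\theta$. (iii) Let $1<p<2$, and let $\bar x=(\bar t_1,\bar t_2,\dots)\in l_p\setminus\{\theta\}$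 and $v=\{s_n\}_{n=1}^\infty\in l_p\setminus\{\theta\}$, with $\{\lambda_n\}_{n=1}^\infty$ the ratio sequence of $v$ with respect to $\bar x$. (a) If $\mathcal N(v)\nsubseteq\mathcal N(\bar x)$, then $J$ is not Gâteaux directionally differentiable at $\bar x$ in direction $v$, i.e. $J'(\bar x,v)$ does not exist. (b) If $\mathcal N(v)\subseteq\mathcal N(\bar x)$ and $v$ is ratio bounded with respect to $\bar x$, then $J$ is Gâteaux directionally differentiable at $\bar x$ in direction $v$ and $J'(\bar x,v)$ is given by the right-hand side of $( * )$. In particular: ($b_1$) if $\mathcal N(v)\subseteq\mathcal N(\bar x)$ and $0<|\mathcal N(v)|<\infty$, then $J$ is Gâteaux directionally differentiable at $\bar x$ in direction $v$ and $J'(\bar x,v)$ is given by the right-hand side of $( * )$; ($b_2$) if $\mathcal N(v)\subseteq\mathcal N(\bar x)$ and $0<|\mathcal N(\bar x)|<\infty$, then $J$ is Gâteaux directionally differentiable at $\bar x$ in direction $v$ and $J'(\bar x,v)$ is given by the right-hand side of $( * )$. (iv) Let $1<p<\infty$. For any $\bar x\in l_p\setminus\{\theta\}$, $J$ is Gâteaux directionally differentiable at $\bar x$ in direction $\bar x$ and $J'(\bar x,\bar x)=J(\bar x)$. In particular, $J'(\bar x,\bar x)=\bar x$ for any $\bar x\in l_p$ with $|\mathcal N(\bar x)|=1$.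
   Context: $(l_p,\|\cdot\|_p)$ and $(l_q,\|\cdot\|_q)$ are the real sequence spaces with $1<p,q<\infty$, $\frac1p+\frac1q=1$, so $l_p^*=l_q$; $\theta=(0,0,\dots)$; $\langle\cdot,\cdot\rangle$ is the canonical real pairing. The normalized duality mapping $J:l_p\to l_q$ is the single-valued map determined by $\langle J(x),x\rangle=\|J(x)\|_q\|x\|_p=\|x\|_p^2=\|J(x)\|_q^2$; explicitly $J(\theta)=\theta$ and, for $x=(t_1,t_2,\dots)\neq\theta$, $J(x)=\left\{\frac{|t_n|^{p-1}\mathrm{sign}(t_n)}{\|x\|_p^{p-2}}\right\}_{n=1}^\infty$. For a real sequence $x=(t_1,t_2,\dots)$, $\mathcal N(x)=\{n\in\mathbb N: t_n\neq0\}$ and $|\mathcal N(x)|$ is its cardinality. For real sequences $\bar x=(\bar t_n)$ and $v=(s_n)$, the ratio sequence $\{\lambda_n\}$ of $v$ with respect to $\bar x$ is defined by $\lambda_n=0$ if $\bar t_n=0$ and $\lambda_n=s_n/\bar t_n$ if $\bar t_n\ne0$; $v$ is ratio bounded with respect to $\bar x$ if $\{\lambda_n\}$ is a bounded sequence. A sequence times an infinite diagonal matrix is computed as a row vector times the matrix (entrywise multiplication by the diagonal entries). For $\bar x\in l_p$, $v\in l_p\setminus\{\theta\}$, $J$ is Gâteaux directionally differentiable at $\bar x$ in direction $v$ if the limit $J'(\bar x,v)=\lim_{t\to0}\frac{J(\bar x+tv)-J(\bar x)}{t}$ exists in the norm of $l_q$ ($t$ real, two-sided limit). $J$ is Gâteaux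 differentiable at $\bar x$ if this holds for every $v\in l_p\setminus\{\theta\}$, and then one writes $J'(\bar x)(v)=J'(\bar x,v)$. *)

(* Defs.v *)
From HB Require Import structures.
From mathcomp Require Import all_boot all_order all_algebra.
From mathcomp Require Import all_classical all_reals all_analysis.
From mathcomp Require Import ring lra.

Set Implicit Arguments.
Unset Strict Implicit.
Unset Printing Implicit Defensive.

Import Order.TTheory GRing.Theory Num.Theory.
Import numFieldNormedType.Exports.

Local Open Scope classical_set_scope.
Local Open Scope ring_scope.

Fact lt1_le1E (R : realType) (p : R) : 1 < p -> (1 <= p%:E)%E.
Proof. by move=> p1; rewrite lee_fin ltW. Qed.

(* The elements of [LfunType] are functions, not classes modulo almost
   everywhere equality, so this is exactly the set of p-summable sequences. *)
Definition lp (R : realType) (p : R) (p1 : 1 < p) : Type :=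
  LfunType (@counting nat R) (lt1_le1E p1).

Section lp_normed.
Context (R : realType) (p : R) (p1 : 1 < p).

HB.instance Definition _ := GRing.Lmodule.copy (lp p1) (LfunType (@counting nat R) (lt1_le1E p1)).

Definition lp_norm (x : lp p1) : R := fine ('N[@counting nat R]_p%:E[EFin \o x]).

Lemma lp_normD (x y : lp p1) : lp_norm (x + y) <= lp_norm x + lp_norm y.
Proof. exact: ler_LnormD. Qed.

Lemma lp_normZ (a : R) (x : lp p1) : lp_norm (a *: x) = `|a| * lp_norm x.
Proof.
apply/EFin_inj; rewrite /lp_norm EFinM !finite_norm_fine.
exact: LnormZ.
Qed.

Lemma lp_normE (x : lp p1) :
  (lp_norm x `^ p)%:E = (\sum_(k <oo) (`|x k| `^ p)%:E)%E.
Proof.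
have p0 : p != 0 by rewrite gt_eqF// (lt_trans _ p1).
rewrite -poweR_EFin /lp_norm finite_norm_fine powR_Lnorm//.
by rewrite ge0_integral_count// => k; rewrite lee_fin powR_ge0.
Qed.

Lemma lp_norm_ge0 (x : lp p1) : 0 <= lp_norm x.
Proof. by apply: fine_ge0; exact: Lnorm_ge0. Qed.

Lemma lp_eqP (x y : lp p1) : x =1 y -> x = y.
Proof. by move=> xy; apply/(@LfuneqP _ _ _ _ _ (lt1_le1E p1)). Qed.

Lemma lp_norm_eq0 (x : lp p1) : lp_norm x = 0 -> x = 0.
Proof.
move=> x0; apply/lp_eqP => n.
have p0 : 0 < p := lt_trans ltr01 p1.
have := lp_normE x; rewrite x0 powR0 ?gt_eqF// => xE.
have : (\sum_(n <= k < n.+1) (`|x k| `^ p)%:E <= 0)%E.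
  rewrite [leRHS]xE.
  have u0 k : true -> (0 <= (`|x k| `^ p)%:E)%E by rewrite lee_fin powR_ge0.
  apply: (@le_trans _ _ (\sum_(0 <= k < n.+1) (`|x k| `^ p)%:E)%E); last first.
    by apply: nneseries_lim_ge => k _; apply: u0.
  by rewrite [leRHS](big_cat_nat (n := n))//= leeDr// sume_ge0.
rewrite big_nat1 lee_fin => xn0.
have /eqP : `|x n| `^ p = 0 by apply/eqP; rewrite eq_le xn0 powR_ge0.
by rewrite powR_eq0 normr_eq0 => /andP[/eqP -> _].
Qed.

HB.instance Definition _ :=
  @Lmodule_isNormed.Build R (lp p1) lp_norm lp_normD lp_normZ lp_norm_eq0.

Lemma lp_norm_cvg (x : lp p1) :
  series (fun k => `|x k| `^ p) @ \oo --> `|x| `^ p.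
Proof.
apply: (@fine_cvg _ _ _ _ (EFin \o series (fun k => `|x k| `^ p))).
rewrite lp_normE.
have -> : (EFin \o series (fun k => `|x k| `^ p)) =
    (fun n => \sum_(0 <= k < n) (`|x k| `^ p)%:E)%E.
  by apply/funext => n; rewrite /= /series /= -sumEFin.
by apply: is_cvg_nneseries => k _ _; rewrite lee_fin powR_ge0.
Qed.

Lemma lp_mem (f : R^nat) : cvgn (series (fun k => `|f k| `^ p)) ->
  f \in Lfun (@counting nat R) p%:E.
Proof.
move=> cf; rewrite inE; apply/andP; split; rewrite inE//=.
rewrite /finite_norm Lnorm_counting ?(lt_trans _ p1)//.
have -> : (\sum_(k <oo) `|(EFin \o f) k| `^ p =
    (limn (series (fun k => `|f k| `^ p)))%:E)%E.
  apply/cvg_lim => //.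
  have -> : (fun n => \sum_(0 <= k < n) `|(EFin \o f) k| `^ p)%E =
      EFin \o series (fun k => `|f k| `^ p).
    by apply/funext => n; rewrite /= /series /= -sumEFin.
  by apply: cvg_EFin; [exact: nearW|exact: cf].
by rewrite poweR_EFin ltry.
Qed.

End lp_normed.

Section duality_mapping.
Context (R : realType) (p q : R) (p1 : 1 < p) (q1 : 1 < q).

Definition pairing (y : lp q1) (x : lp p1) : R :=
  limn (series (fun n => y n * x n)).

(* At x = 0 the factor [`|x n| `^ (p - 1)] is 0 because p != 1, so the formula
   also covers the convention J 0 = 0. *)
Definition J_seq (x : lp p1) : R^nat :=
  fun n => `|x n| `^ (p - 1) * Num.sg (x n) / `|x| `^ (p - 2).

Context (pq : p^-1 + q^-1 = 1).

Let p0 : 0 < p. Proof. exact: lt_trans p1. Qed.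
Let q0 : 0 < q. Proof. exact: lt_trans q1. Qed.

Let pDq : p + q = p * q.
Proof.
rewrite -[RHS]mulr1 -pq mulrDr mulrAC mulfV ?gt_eqF// mul1r.
by rewrite mulfK ?gt_eqF// addrC.
Qed.

Lemma normr_J_seq (x : lp p1) n :
  `|J_seq x n| = `|x n| `^ (p - 1) / `|x| `^ (p - 2).
Proof.
rewrite /J_seq !normrM normfV normr_sg !(ger0_norm (powR_ge0 _ _)).
have [->|xn0] := eqVneq (x n) 0; last by rewrite mulr1.
by rewrite normr0 powR0 ?subr_eq0 ?gt_eqF// !mul0r.
Qed.

Lemma J_seq_powR (x : lp p1) n :
  `|J_seq x n| `^ q = (`|x| `^ ((2 - p) * q)) * `|x n| `^ p.
Proof.
rewrite normr_J_seq powRM ?powR_ge0 ?invr_ge0 ?powR_ge0//.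
rewrite -powRN -!powRrM mulrC; congr (_ `^ _ * _ `^ _); last first.
  by rewrite mulrBl mul1r -pDq addrK.
by rewrite opprB.
Qed.

Lemma J_seq_cvg (x : lp p1) :
  series (fun n => `|J_seq x n| `^ q) @ \oo -->
    `|x| `^ ((2 - p) * q) * `|x| `^ p.
Proof.
under [X in series X]eq_fun do rewrite J_seq_powR.
have -> : series (fun n => `|x| `^ ((2 - p) * q) * `|x n| `^ p) =
    (fun n => `|x| `^ ((2 - p) * q) * series (fun n => `|x n| `^ p) n).
  by apply/funext => n; rewrite /series /= mulr_sumr.
by apply: cvgMl_tmp; exact: lp_norm_cvg.
Qed.

Fact J_mem (x : lp p1) : J_seq x \in Lfun (@counting nat R) q%:E.
Proof. by apply: (lp_mem q1); apply/cvg_ex; eexists; exact: J_seq_cvg. Qed.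

Definition J (x : lp p1) : lp q1 := Lfun_Sub (lt1_le1E q1) (J_mem x).

Lemma JE x : J x = J_seq x :> R^nat.
Proof. exact: Lfun_valP. Qed.

Lemma norm_J x : `|J x| = `|x|.
Proof.
apply: (powR_injective q0); rewrite ?nnegrE ?normr_ge0//.
have JN : series (fun n => `|J x n| `^ q) @ \oo -->
    `|x| `^ ((2 - p) * q) * `|x| `^ p by rewrite JE; exact: J_seq_cvg.
rewrite -(cvg_lim (@Rhausdorff R) (@lp_norm_cvg _ _ _ (J x))).
rewrite (cvg_lim (@Rhausdorff R) JN).
have [->|x0] := eqVneq x 0.
  by rewrite normr0 [0 `^ p]powR0 ?[0 `^ q]powR0 ?gt_eqF// mulr0.
rewrite -powRD ?normr_eq0 ?x0 ?implybT//; congr (_ `^ _).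
by have := pDq; lra.
Qed.

Lemma pairing_J x : pairing (J x) x = `|x| ^+ 2.
Proof.
have [->|x0] := eqVneq x 0.
  rewrite normr0 expr0n/=; apply: cvg_lim => //.
  rewrite (_ : series _ = fun=> 0) ?cvg_cst//; first exact: cvg_cst.
  apply/funext => n; rewrite /series /= big1// => k _.
  by rewrite mulr0.
apply: cvg_lim => //.
have xp : `|x| `^ (p - 2) != 0 by rewrite powR_eq0 normr_eq0 (negbTE x0).
have -> : series (fun n => J x n * x n) =
    (fun n => series (fun n => `|x n| `^ p) n * (`|x| `^ (p - 2))^-1).
  apply/funext => n; rewrite /series /= mulr_suml; apply: eq_bigr => k _.
  rewrite /J_seq mulrAC; congr (_ * _).
  rewrite -mulrA -normrEsg -[X in _ * X]powRr1// -powRD ?subrK//.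
  by rewrite gt_eqF.
have -> : `|x| ^+ 2 = `|x| `^ p * (`|x| `^ (p - 2))^-1.
  apply: (mulIf xp); rewrite mulfVK// -powR_mulrn// -powRD ?normr_eq0 ?x0 ?implybT//.
  by rewrite addrC subrK.
by apply: cvgMr_tmp; exact: lp_norm_cvg.
Qed.

Lemma young_eq (a b : R) : 0 <= a -> 0 <= b ->
  a `^ p / p + b `^ q / q = a * b -> b = a `^ (p - 1).
Proof.
rewrite le_eqVlt => /predU1P[<-|a0] b0.
  rewrite !powR0 ?subr_eq0 ?gt_eqF// !mul0r add0r => /eqP.
  rewrite mulf_eq0 invr_eq0 [q == 0]gt_eqF// orbF powR_eq0.
  by move=> /andP[/eqP].
move: b0; rewrite le_eqVlt => /predU1P[<-|b0].
  rewrite mulr0 [0 `^ q]powR0 ?gt_eqF// mul0r addr0 => /eqP.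
  by rewrite gt_eqF// divr_gt0// powR_gt0.
set u := p * ln a; set v := q * ln b.
have ua : a `^ p = expR u by rewrite /powR gt_eqF.
have vb : b `^ q = expR v by rewrite /powR gt_eqF.
pose m := ln a + ln b.
have -> : a * b = expR m by rewrite expRD !lnK.
have um : u / p = ln a by rewrite /u mulrC mulKf// gt_eqF.
have vm : v / q = ln b by rewrite /v mulrC mulKf// gt_eqF.
have [uv|uv] := eqVneq u v.
  move=> _; rewrite /powR gt_eqF// mulrBl mul1r.
  have <- : ln b = p * ln a - ln a.
    apply: (mulfI (lt0r_neq0 q0)); rewrite mulrBr mulrA [q * p]mulrC -pDq.
    rewrite mulrDl addrK; exact/esym.
  by rewrite lnK.
rewrite ua vb => h.
have mE : m = u / p + v / q by rewrite um vm.
clearbody m.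
have lt1 (w : R) : w != m -> expR m * (1 + (w - m)) < expR w.
  move=> wm; rewrite -[X in _ < expR X](subrKC m w) expRD ltr_pM2l ?expR_gt0//.
  by apply: expR_gt1Dx; rewrite subr_eq0.
have um' : u != m.
  apply: contra uv => /eqP umE; apply/eqP/(mulIf (invr_neq0 (lt0r_neq0 q0))).
  have : u / p + u / q = u by rewrite -mulrDr pq mulr1.
  by rewrite {3}umE mE => /addrI.
have vm' : v != m.
  apply: contra uv => /eqP vmE; apply/eqP/(mulIf (invr_neq0 (lt0r_neq0 p0))).
  have : v / p + v / q = v by rewrite -mulrDr pq mulr1.
  by rewrite {3}vmE mE => /addIr.
have : expR m * (1 + (u - m)) / p + expR m * (1 + (v - m)) / q
    < expR u / p + expR v / q.
  by apply: ltrD; rewrite ltr_pM2r ?invr_gt0// lt1.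
have -> : expR m * (1 + (u - m)) / p + expR m * (1 + (v - m)) / q =
    expR m * ((p^-1 + q^-1) + (u / p + v / q) - m * (p^-1 + q^-1)) by ring.
by rewrite h pq -mE mulr1 addrK mulr1 ltxx.
Qed.

Lemma pairing_cvg (y : lp q1) (x : lp p1) :
  cvgn (series (fun n => y n * x n)).
Proof.
apply: normed_cvg.
apply: (@series_le_cvg _ _ (fun n => `|x n| `^ p / p + `|y n| `^ q / q)).
- by move=> n; exact: normr_ge0.
- by move=> n; rewrite addr_ge0// divr_ge0 ?powR_ge0// ltW.
- by move=> n /=; rewrite normrM mulrC conjugate_powR.
- have -> : series (fun n => `|x n| `^ p / p + `|y n| `^ q / q) =
      (fun n => series (fun n => `|x n| `^ p) n / p
        + series (fun n => `|y n| `^ q) n / q).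
    by apply/funext => n; rewrite /series /= !mulr_suml big_split.
  apply: is_cvgD; apply: is_cvgMr_tmp; apply/cvg_ex; eexists; exact: lp_norm_cvg.
Qed.

Lemma J_unique (x : lp p1) (y : lp q1) :
  pairing y x = `|y| * `|x| -> `|y| = `|x| -> y = J x.
Proof.
move=> yx nyx.
have [x0|x0] := eqVneq x 0.
  have -> : y = 0 by apply/normr0_eq0; rewrite nyx x0 normr0.
  by apply/esym/normr0_eq0; rewrite norm_J x0 normr0.
have N0 : 0 < `|x| by rewrite normr_gt0.
set N := `|x| in nyx yx N0.
have invN r : N^-1 `^ r = (N `^ r)^-1.
  by rewrite -(powR_inv1 (ltW N0)) -powRrM mulN1r powRN.
pose h n := (`|x n| / N) `^ p / p + (`|y n| / N) `^ q / q - y n * x n / (N ^+ 2).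
have hy n : y n * x n / N ^+ 2 <= (`|x n| / N) * (`|y n| / N).
  rewrite mulrACA -invfM -expr2 ler_pM2r ?invr_gt0 ?exprn_gt0//.
  by rewrite mulrC (le_trans (ler_norm _))// normrM.
have aN n : 0 <= `|x n| / N by rewrite divr_ge0// ltW.
have bN n : 0 <= `|y n| / N by rewrite divr_ge0// ltW.
have hab n : (`|x n| / N) * (`|y n| / N) <=
  (`|x n| / N) `^ p / p + (`|y n| / N) `^ q / q by rewrite conjugate_powR.
have h0 n : 0 <= h n by rewrite subr_ge0 (le_trans (hy n)).
have cvgh : series h @ \oo --> (0 : R).
  have -> : series h = (fun n => series (fun n => `|x n| `^ p) n * (N `^ p)^-1 / p
        + series (fun n => `|y n| `^ q) n * (N `^ q)^-1 / q
        - series (fun n => y n * x n) n / N ^+ 2).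
    apply/funext => n; rewrite /series /= !mulr_suml -big_split/= -sumrB.
    apply: eq_bigr => k _; rewrite /h !powRM// ?invr_ge0 ?(ltW N0)//.
    by rewrite !invN.
  have -> : (0 : R) = N `^ p * (N `^ p)^-1 / p + N `^ q * (N `^ q)^-1 / q - N ^+ 2 / N ^+ 2.
    rewrite !mulfV ?gt_eqF ?powR_gt0 ?exprn_gt0// !mul1r pq subrr//.
  apply: cvgB; first apply: cvgD.
  - by apply: cvgMr_tmp; apply: cvgMr_tmp; exact: lp_norm_cvg.
  - by apply: cvgMr_tmp; apply: cvgMr_tmp; rewrite -nyx; exact: lp_norm_cvg.
  - apply: cvgMr_tmp; rewrite expr2 -{1}nyx -yx; exact: pairing_cvg.
have hE n : h n = 0.
  apply/eqP; rewrite eq_le h0 andbT.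
  have nd : nondecreasing_seq (series h) by apply: nondecreasing_series => k _ _.
  have := nondecreasing_cvgn_le nd (cvgP _ cvgh) n.+1.
  rewrite (cvg_lim _ cvgh)//; apply: le_trans.
  by rewrite /series/= big_nat_recr//= lerDr sumr_ge0.
apply/lp_eqP => n; rewrite JE /J_seq.
have eq1 : (`|x n| / N) `^ p / p + (`|y n| / N) `^ q / q = y n * x n / N ^+ 2.
  by apply/eqP; rewrite -subr_eq0; apply/eqP; exact: hE.
have eq2 : (`|x n| / N) `^ p / p + (`|y n| / N) `^ q / q = (`|x n| / N) * (`|y n| / N).
  by apply/eqP; rewrite eq_le hab andbT eq1 hy.
have eq3 : y n * x n = `|y n| * `|x n|.
  move: eq2; rewrite eq1 mulrACA -invfM -expr2 => /mulIf -> //; last first.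
    by rewrite invr_eq0 expf_neq0// gt_eqF.
  by rewrite mulrC.
have := young_eq (aN n) (bN n) eq2.
rewrite powRM ?invr_ge0 ?(ltW N0)// => /(congr1 (fun z => z * N)).
rewrite mulfVK ?gt_eqF// invN -powRN => ynE.
have {}ynE : `|y n| = `|x n| `^ (p - 1) / N `^ (p - 2).
  rewrite ynE -powRN -mulrA; congr (_ * _).
  rewrite -[X in _ * X = _](powRr1 (ltW N0)) -powRD ?(gt_eqF N0) ?implybT//.
  by congr (_ `^ _); ring.
rewrite mulrAC -ynE.
have [xn0|xn0] := eqVneq (x n) 0.
  rewrite xn0 sgr0 mulr0; apply/normr0_eq0.
  by rewrite ynE xn0 normr0 powR0 ?mul0r// subr_eq0 gt_eqF.
apply: (mulIf xn0); rewrite eq3 -mulrA; congr (_ * _).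
by rewrite -normrEsg.
Qed.

Lemma J_dualityP (x : lp p1) (y : lp q1) :
  [/\ pairing y x = `|y| * `|x|, `|y| * `|x| = `|x| ^+ 2
    & `|x| ^+ 2 = `|y| ^+ 2] <-> y = J x.
Proof.
split=> [[yx _ /eqP]|->].
  by rewrite eqrXn2// => /eqP xy; apply: J_unique.
by rewrite pairing_J norm_J.
Qed.

End duality_mapping.

Arguments J {R p q} p1 q1 pq x.

Section sequences.
Context {R : realType}.
Implicit Types (x v d : R^nat) (A : nat -> nat -> R).

Definition nzset x : set nat := [set n | x n != 0].

Definition ratio_seq x v : R^nat := fun n => if x n == 0 then 0 else v n / x n.

(* Infinite matrices are functions [nat -> nat -> R], with the pointwise
   module structure; [rowmul x A] is the row vector [x] times [A]. *)
Definition infdiag d : nat -> nat -> R := fun i j => if i == j then d i else 0.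

Definition rowmul x A : R^nat :=
  fun j => limn (series (fun i => x i * A i j)).

Lemma infdiagB (a b : R) d d' :
  a *: infdiag d - b *: infdiag d' = infdiag (a *: d - b *: d').
Proof.
apply/funext => i; apply/funext => j.
transitivity (a * infdiag d i j - b * infdiag d' i j) => //.
by rewrite /infdiag; case: eqP => // _; rewrite !mulr0 subr0.
Qed.

Lemma rowmul_infdiag x d : rowmul x (infdiag d) = (fun n => x n * d n).
Proof.
apply/funext => j; apply: cvg_lim => //.
apply: cvg_near_cst.
near=> n.
have jn : (j < n)%N by near: n; exact: nbhs_infty_gt.
rewrite /series/= (bigD1_seq j) ?mem_index_iota ?iota_uniq//= /infdiag eqxx.
by rewrite big1 ?addr0// => i /negbTE ->; rewrite mulr0.
Unshelve. all: by end_near. Qed.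

End sequences.

Lemma ratio_seq_cvg (R : realType) (p q : R) (p1 : 1 < p) (q1 : 1 < q)
    (pq : p^-1 + q^-1 = 1) (x v : lp p1) :
  cvgn (series (fun i => ratio_seq x v i * `|x i| `^ p)).
Proof.
have [x0|x0] := eqVneq x 0.
  have -> : series (fun i => ratio_seq x v i * `|x i| `^ p) = (fun=> 0).
    apply/funext => n; rewrite /series/= big1// => i _.
    by rewrite /ratio_seq x0 eqxx mul0r.
  exact: is_cvg_cst.
have xp : `|x| `^ (p - 2) != 0 by rewrite powR_eq0 normr_eq0 (negbTE x0).
have -> : series (fun i => ratio_seq x v i * `|x i| `^ p) =
    (fun n => `|x| `^ (p - 2) * series (fun i => J p1 q1 pq x i * v i) n).
  apply/funext => n; rewrite /series /= mulr_sumr; apply: eq_bigr => i _.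
  rewrite /J_seq /ratio_seq.
  have [->|xi0] := eqVneq (x i) 0; first by rewrite sgr0 mulr0 !mul0r mulr0.
  have -> : `|x i| `^ p = `|x i| `^ (p - 1) * `|x i|.
    by rewrite -[X in _ * X]powRr1// -powRD ?subrK// gt_eqF// (lt_trans _ p1).
  rewrite normrEsg.
  set a := (_ `^ (p - 1)); set b := Num.sg _.
  have -> : `|x| `^ (p - 2) * (a * b / `|x| `^ (p - 2) * v i) = a * b * v i.
    by rewrite mulrAC mulrCA mulfV// mulr1.
  by field.
by apply: is_cvgMl_tmp; exact: pairing_cvg.
Qed.

Definition gateaux_differentiable (R : realType) (V W : normedModType R)
    (f : V -> W) (x : V) :=
  forall v, v != 0 -> derivable f x v.

Definition J_deriv_formula (R : realType) (p q : R) (p1 : 1 < p) (q1 : 1 < q)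
    (pq : p^-1 + q^-1 = 1) (x v : lp p1) : R^nat :=
  rowmul (J p1 q1 pq x)
    ((p - 1) *: infdiag (ratio_seq x v)
     - ((p - 2) * limn (series (fun i => ratio_seq x v i * `|x i| `^ p))
          / limn (series (fun i => `|x i| `^ p))) *: infdiag (fun=> 1)).

Arguments J_deriv_formula {R p q} p1 q1 pq x v.

(* Main.v *)
Require Import Defs.
From mathcomp Require Import all_boot all_order all_algebra.
From mathcomp Require Import all_classical all_reals all_analysis.
From mathcomp Require Import ring lra.

(** Up to a scalar function of the norm, [J] acts entrywise: for every [x],
[J x = |x| `^ (2 - p) *: dualpow x], where [dualpow x] has the entries
[spowR (p - 1) (x n) = |x n| `^ (p - 1) * sg (x n)]. The derivative is
given by the product rule for these two factors ([is_derive_scale],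
[is_derive_J]).

The scalar factor is differentiable in every direction at every nonzero point,
whatever [p > 1] is: the difference quotients of [|x n| `^ p] are dominated by
the summable sequence [p * (|x n| + |v n|) `^ p], so [|x| `^ p] can be
differentiated term by term ([is_derive_lp_norm_powR]), and any other power of
the norm follows by the chain rule ([is_derive_lp_norm]).

Hence everything depends on the difference quotients of [spowR (p - 1)] along
[x + h v]. They converge entry by entry as soon as [spowR (p - 1)] is
differentiable at [x n] or [v n = 0], and then convergence in [l_q] holds once
they are dominated by a single element of [l_q] ([lp_dominated_cvg]).

- For [p > 2], [spowR (p - 1)] is continuously differentiable on the whole line
  and the mean value theorem gives the majorant
  [(p - 1) * (|x n| + |v n|) `^ (p - 1)], whose [q]-th power is a multiple of
  [(|x n| + |v n|) `^ p].
- For [p < 2] the derivative of [spowR (p - 1)] is unbounded near 0. If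
  [v n = lambda n * x n] with [|lambda n| <= M], multiplicativity of [spowR]
  reduces the quotient to that of [spowR (p - 1)] at 1, which gives the majorant
  [M * |x n| `^ (p - 1)].
- For [p < 2], [x n = 0] and [v n != 0], the [n]-th entry of the quotient of
  [J] grows like [|h| `^ (p - 2)], so there is no limit ([not_derivable_J]).

The derivatives at 0 and in the direction [x] only use that [J] is homogeneous
([JZ]): the difference quotients are constant. *)

Set Implicit Arguments.
Unset Strict Implicit.
Unset Printing Implicit Defensive.

Import Order.TTheory GRing.Theory Num.Theory.
Import numFieldNormedType.Exports.

Local Open Scope classical_set_scope.
Local Open Scope ring_scope.

(** * Directional derivatives *)

(** Directional derivatives are handled below as explicit limits of difference
quotients. *)
Lemma is_deriveP {R : realType} {V W : normedModType R} (f : V -> W)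
    (x v : V) (d : W) :
  (fun h : R => h^-1 *: (f (h *: v + x) - f x)) @ 0^' --> d <->
  is_derive x v f d.
Proof.
split=> [fd|[df <-]]; last exact: df.
by split; [apply/cvg_ex; exists d|apply: cvg_lim].
Qed.

Section directional.
Context {R : realType} {V : normedModType R}.

(** Continuity along the line through [x] with direction [v], which holds even
when [f] is not continuous at [x]. *)
Lemma is_derive_cvg {W : normedModType R} (f : V -> W) (x v : V) (d : W) :
  is_derive x v f d -> f (h *: v + x) @[h --> (0 : R)^'] --> f x.
Proof.
move=> /is_deriveP fd; apply/subr_cvg0.
have h0 : id @ 0^' --> (0 : R) by exact: nbhs_dnbhs.
rewrite -(scale0r d); apply: cvg_trans (cvgZ h0 fd).
apply: near_eq_cvg; near=> h.
by rewrite scalerA divff ?scale1r//; near: h; exact: nbhs_dnbhs_neq.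
Unshelve. all: by end_near. Qed.

Lemma is_derive_scale {W : normedModType R} (k : V -> R) (f : V -> W)
    (x v : V) a d :
  is_derive x v k a -> is_derive x v f d ->
  is_derive x v (fun y => k y *: f y) (k x *: d + a *: f x).
Proof.
move=> dk df; apply/is_deriveP.
have := is_derive_cvg dk => ck.
move/is_deriveP : dk => dk; move/is_deriveP : df => df.
apply: cvg_trans (cvgD (cvgZ ck df) (cvgZ dk (cvg_cst (f x)))).
apply: near_eq_cvg; apply: nearW => h /=.
rewrite -[LHS]/(_ *: (_ *: _) + (_ * _) *: _).
by rewrite scalerA mulrC -!scalerA -scalerDr scalerBr scalerBl addrA subrK.
Qed.

(** Restricted to the line through [x] with direction [v], this is the
one-variable chain rule. *)
Lemma is_derive_comp1 (f : V -> R) (g : R -> R) (x v : V) a b :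
  is_derive (f x) 1 g a -> is_derive x v f b ->
  is_derive x v (fun y => g (f y)) (a * b).
Proof.
move=> dg /is_deriveP df; apply/is_deriveP.
pose F (h : R) := f (h *: v + x).
have dF : is_derive (0 : R) (1 : R) F b.
  apply/is_deriveP; apply: cvg_trans df; apply: near_eq_cvg; apply: nearW => h.
  by rewrite /F addr0 scale0r add0r [h *: 1]mulr1.
have dg' : is_derive (F 0) 1 g a by rewrite /F scale0r add0r.
have /is_deriveP := is_derive1_comp dg' dF.
apply: cvg_trans; apply: near_eq_cvg; apply: nearW => h.
by rewrite /F /= addr0 scale0r add0r [h *: 1]mulr1.
Qed.

End directional.

Lemma growth_rate_cvg {R : realType} (f : R -> R) (x v d : R) :
  is_derive x 1 f d ->
  h^-1 * (f (h * v + x) - f x) @[h --> (0 : R)^'] --> v * d.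
Proof.
move=> df.
pose g (h : R) := h * v + x.
have dg : is_derive (0 : R) 1 g v.
  apply/is_deriveP; apply: cvg_near_cst; near=> h.
  have h0 : h != 0 by near: h; exact: nbhs_dnbhs_neq.
  rewrite /g mul0r add0r addr0 addrK [h *: 1]mulr1.
  by rewrite [_ *: _]mulKf.
have dg0 : is_derive (g 0) 1 f d by rewrite /g mul0r add0r.
have /is_deriveP := is_derive_comp1 dg0 dg; rewrite mulrC.
apply: cvg_trans; apply: near_eq_cvg; apply: nearW => h.
by rewrite /g /= addr0 mul0r add0r [h *: 1]mulr1.
Unshelve. all: by end_near. Qed.

(** * Powers on the real line *)

(** The odd extension of the power function on the half-line, needed because
[powR] takes the value 1 at negative arguments. *)
Definition spowR {R : realType} (r s : R) : R := `|s| `^ r * Num.sg s.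

Section signed_power.
Context {R : realType}.
Implicit Types (r s a b : R).

Lemma spowRM r a b : spowR r (a * b) = spowR r a * spowR r b.
Proof. by rewrite /spowR normrM powRM// sgrM mulrACA. Qed.

Lemma spowR0 r : spowR r 0 = 0.
Proof. by rewrite /spowR sgr0 mulr0. Qed.

Lemma norm_spowR r s : r != 0 -> `|spowR r s| = `|s| `^ r.
Proof.
move=> r0; rewrite /spowR normrM normr_sg ger0_norm ?powR_ge0//.
by have [->|_] := eqVneq s 0; rewrite ?mulr1// mulr0 normr0 powR0.
Qed.

Lemma ger0_spowR r s : r != 0 -> 0 <= s -> spowR r s = s `^ r.
Proof.
move=> r0; rewrite le_eqVlt => /predU1P[<-|s0]; first by rewrite spowR0 powR0.
by rewrite /spowR gtr0_norm// gtr0_sg// mulr1.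
Qed.

Lemma mulr_spowRB1 r s : 0 < r -> s * spowR (r - 1) s = `|s| `^ r.
Proof.
move=> r0; rewrite -(@mulr_powRB1 _ `|s|)// /spowR mulrCA mulrC; congr (_ * _).
by rewrite mulrC -normrEsg.
Qed.

Lemma cvg_norm_powR0 {T} {F : set_system T} {FF : Filter F} (f : T -> R) r :
  0 < r -> f @ F --> 0 -> (fun t => `|f t| `^ r) @ F --> 0.
Proof.
move=> r0 f0; apply/cvgr0Pnorm_lt => e e0.
have er0 : 0 < e `^ r^-1 by rewrite powR_gt0.
near=> t; rewrite ger0_norm ?powR_ge0//.
have -> : e = (e `^ r^-1) `^ r by rewrite -powRrM mulVf ?gt_eqF// powRr1 ?ltW.
apply: gt0_ltr_powR; rewrite ?nnegrE ?(ltW er0)//.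
by near: t; apply: (cvgr0_norm_lt _ f0).
Unshelve. all: by end_near. Qed.

(** The quotients at 0 have absolute value [|h| `^ (r - 1)]: this covers both
[spowR r] and [|s| `^ r] at the only point where the sign of [s] changes. *)
Lemma is_derive0_normM (f : R -> R) r : 1 < r -> f 0 = 0 ->
  (forall s, `|f s| = `|s| `^ r) -> is_derive (0 : R) (1 : R) f 0.
Proof.
move=> r1 f0 fr; have r0 : 0 < r := lt_trans ltr01 r1.
apply/is_deriveP/norm_cvg0P.
have : (fun h : R => `|h| `^ (r - 1)) @ 0^' --> (0 : R).
  by apply: (@cvg_norm_powR0 _ _ _ id); [rewrite subr_gt0|exact: nbhs_dnbhs].
apply: cvg_trans; apply: near_eq_cvg; near=> h.
have h0 : `|h| != 0 by rewrite normr_eq0; near: h; exact: nbhs_dnbhs_neq.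
rewrite f0 subr0 addr0 normrZ normfV fr [h *: 1]mulr1.
by rewrite -(mulr_powRB1 (normr_ge0 h) r0) mulKf.
Unshelve. all: by end_near. Qed.

Lemma is_derive_spowR r s : (s != 0) || (1 < r) ->
  is_derive s 1 (spowR r) (r * `|s| `^ (r - 1)).
Proof.
have [->/= r1|s0 _] := eqVneq s 0.
  have r0 : r != 0 by rewrite gt_eqF// (lt_trans ltr01).
  rewrite normr0 powR0 ?subr_eq0 ?gt_eqF// mulr0.
  by apply: is_derive0_normM r1 (spowR0 _) _ => s'; exact: norm_spowR.
have [s_lt0|s_gt0] := ltP s 0.
  apply: (@near_eq_is_derive _ _ _ (- ((@powR R)^~ r \o -%R))).
    near=> t; have t0 : t < 0 by near: t; exact: lt_nbhsl.
    by rewrite /spowR /= ltr0_norm// ltr0_sg// mulrN1.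
  have ns : 0 < - s by rewrite oppr_gt0.
  have := is_derive1_powR r ns => dp.
  apply: is_derive_eq; rewrite ltr0_norm//; ring.
have {}s0 : 0 < s by rewrite lt_neqAle eq_sym s0.
apply: (@near_eq_is_derive _ _ _ ((@powR R)^~ r)).
  near=> t; have t0 : 0 < t by near: t; exact: lt_nbhsr.
  by rewrite /spowR /= gtr0_norm// gtr0_sg// mulr1.
by rewrite gtr0_norm//; exact: is_derive1_powR.
Unshelve. all: by end_near. Qed.

Lemma is_derive_norm_powR r s : 1 < r ->
  is_derive s 1 (fun t => `|t| `^ r) (r * spowR (r - 1) s).
Proof.
move=> r1; have r0 : 0 < r := lt_trans ltr01 r1.
have [->|s0] := eqVneq s 0.
  rewrite spowR0 mulr0; apply: is_derive0_normM r1 _ _ => [|s'].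
    by rewrite normr0 powR0// gt_eqF.
  by rewrite ger0_norm ?powR_ge0.
(* Off 0, the product rule avoids a second case distinction on the sign. *)
have -> : (fun t => `|t| `^ r) = id * (spowR (r - 1)).
  by apply/funext => t; rewrite -mulr_spowRB1.
have := @is_derive_spowR (r - 1) s; rewrite s0 => /(_ isT) ds.
apply: is_derive_eq; rewrite [_ *: 1]mulr1 /=.
suff -> : s *: ((r - 1) * `|s| `^ (r - 1 - 1)) = (r - 1) * spowR (r - 1) s.
  by ring.
rewrite [LHS]mulrCA; congr (_ * _); rewrite /spowR.
rewrite [in RHS]powRB; last by rewrite normr_eq0 s0 implybT.
rewrite powRr1// {1}[s]numEsg.
rewrite powRB ?normr_eq0 ?s0 ?implybT// powRB ?normr_eq0 ?s0 ?implybT//.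
by rewrite powRr1//; field; rewrite normr_eq0.
Qed.

(** Mean value inequality in the form needed for domination: the bound does not
depend on [h]. All points between [x] and [x + h v] have absolute value at most
[|x| + |v|], and the spare factor [|v|] is absorbed in the exponent. *)
Lemma growth_rate_le (f df : R -> R) c r x v h : 1 <= r -> 0 <= c ->
  (forall s, is_derive s 1 f (df s)) ->
  (forall s, `|df s| <= c * `|s| `^ (r - 1)) -> h != 0 -> `|h| <= 1 ->
  `|h^-1 * (f (h * v + x) - f x)| <= c * (`|x| + `|v|) `^ r.
Proof.
move=> r1 c0 df_f df_le h0 h1.
set K := `|x| + `|v|.
have K0 : 0 <= K by rewrite addr_ge0.
have lip a b : `|a| <= K -> `|b| <= K ->
    `|f b - f a| <= c * K `^ (r - 1) * `|b - a|.
  wlog ab : a b / a <= b.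
    move=> H aK bK; have [/H|/ltW/H] := leP a b; first exact.
    by rewrite distrC [`|b - a|]distrC; exact.
  move=> aK bK; have [|y yab ->] := MVT_segment ab (fun s _ => df_f s).
    apply: derivable_within_continuous => s _.
    by case: (df_f s).
  rewrite normrM ler_wpM2r// (le_trans (df_le y))// ler_wpM2l//.
  apply: ge0_ler_powR; rewrite ?nnegrE ?subr_ge0//.
  move: yab; rewrite in_itv/= => /andP[ay yb].
  move: aK bK; rewrite !ler_norml => /andP[aK _] /andP[_ bK].
  by rewrite (le_trans aK)// (le_trans yb).
rewrite normrM normfV ler_pdivrMl ?normr_gt0//.
have vK : `|v| <= K by rewrite /K lerDr.
apply: le_trans (lip _ _ _ _) _.
- by rewrite /K lerDl.
- rewrite (le_trans (ler_normD _ _))// addrC lerD2l normrM.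
  by rewrite ler_piMl.
rewrite addrK normrM mulrCA ler_wpM2l// -mulrA ler_wpM2l//.
rewrite mulrC -[leRHS]mulr_powRB1 ?(lt_le_trans ltr01)//.
by rewrite ler_wpM2r// powR_ge0.
Qed.

(** Since [0 < r <= 1], [(1 + u) `^ r] lies between 1 and [1 + u]. *)
Lemma norm_spowR1D_sub1_le r u : 0 < r <= 1 -> `|u| <= 1 ->
  `|spowR r (1 + u) - 1| <= `|u|.
Proof.
move=> /andP[r0 r1] u1.
have u0 : 0 <= 1 + u by move: u1; rewrite ler_norml => /andP[]; lra.
rewrite ger0_spowR ?gt_eqF//.
have [u_ge0|u_lt0] := leP 0 u.
  have a1 : 1 <= 1 + u by lra.
  rewrite !ger0_norm//; first by rewrite lerBlDl ler1_powR.
  rewrite subr_ge0 -[leLHS](powRr0 (1 + u)).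
  by apply: ler_powR => //; exact: ltW.
rewrite (ltr0_norm u_lt0).
have [u0'|u0'] := eqVneq (1 + u) 0.
  rewrite u0' powR0 ?gt_eqF// sub0r normrN1; lra.
have u01 : 0 < 1 + u <= 1 by rewrite lt_neqAle eq_sym u0' u0/=; lra.
rewrite ler0_norm.
  by have := ger1_powR u01 r1; lra.
by rewrite subr_le0 -[leRHS](powRr0 (1 + u)); apply: ger_powR => //; exact: ltW.
Qed.

End signed_power.

(** * Dominated convergence *)

Section dominated_series.
Context {R : realType}.
Implicit Types (u g : R^nat).

Lemma dominated_is_cvg_series u g : (forall n, `|u n| <= g n) ->
  cvgn (series g) -> cvgn (series u).
Proof.
move=> ug cg; apply: normed_cvg; apply: series_le_cvg cg => n //=.
by rewrite (le_trans _ (ug n)).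
Qed.

(** The tail of the majorant controls all dominated tails uniformly, which is
what allows the interchange of limits below. *)
Lemma dominated_series_tail u g N : (forall n, `|u n| <= g n) ->
  cvgn (series g) ->
  `|limn (series u) - series u N| <= limn (series g) - series g N.
Proof.
move=> ug cg; have cu := dominated_is_cvg_series ug cg.
have cuN : (fun m => `|series u m - series u N|) @ \oo
    --> `|limn (series u) - series u N|.
  by apply: cvg_norm; apply: cvgB; [exact: cu|exact: cvg_cst].
have cgN : (fun m => series g m - series g N) @ \oo
    --> limn (series g) - series g N.
  by apply: cvgB; [exact: cg|exact: cvg_cst].
apply: ler_cvg_to cuN cgN _; near=> m.
have Nm : (N <= m)%N by near: m; exact: nbhs_infty_ge.
by rewrite !sub_series_geq// (le_trans (ler_norm_sum _ _ _))// ler_sum.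
Unshelve. all: by end_near. Qed.

(** Tannery's theorem, along an arbitrary filter: cut the series at an index
where the tail of [g] is small, and pass to the limit in the finite sum. *)
Lemma dominated_cvg_series {T} {F : set_system T} {FF : ProperFilter F}
    (f : T -> R^nat) (l g : R^nat) :
  (\forall t \near F, forall n, `|f t n| <= g n) -> cvgn (series g) ->
  (forall n, f t n @[t --> F] --> l n) ->
  limn (series (f t)) @[t --> F] --> limn (series l).
Proof.
move=> fg cg fl.
have lg n : `|l n| <= g n.
  apply: (cvgr_to_le (cvg_norm (fl n))).
  by apply: filterS fg => t; exact.
apply/cvgrPdist_lt => e e0.
have [N gN] : exists N, limn (series g) - series g N < e / 3.
  have e3 : 0 < e / 3 by rewrite divr_gt0.
  have /cvgrPdist_lt/(_ _ e3)[N _ gN] := cg.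
  exists N; apply: le_lt_trans (gN N _); [exact: ler_norm|exact: leqnn].
have sN : series (f t) N @[t --> F] --> series l N.
  rewrite /series/=; apply: cvg_big => //; exact: add_continuous.
near=> t.
have fgt : forall n, `|f t n| <= g n by near: t.
have -> : limn (series l) - limn (series (f t)) =
    (limn (series l) - series l N) + (series l N - series (f t) N)
    - (limn (series (f t)) - series (f t) N) by ring.
have -> : e = e / 3 + e / 3 + e / 3 by field.
rewrite (le_lt_trans (ler_normB _ _))// ltr_leD//; last first.
  by rewrite (le_trans (dominated_series_tail N fgt cg))// ltW.
rewrite (le_lt_trans (ler_normD _ _))// ltrD//.
  by rewrite (le_lt_trans (dominated_series_tail N lg cg)).
by near: t; move/cvgrPdist_lt : sN; apply; rewrite divr_gt0.
Unshelve. all: by end_near. Qed.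

End dominated_series.

Section lp_theory.
Context {R : realType} {p : R} {p1 : 1 < p}.
Implicit Types x y g : lp p1.

Let p0 : 0 < p. Proof. exact: lt_trans p1. Qed.

Lemma lp_norm_powR x : `|x| `^ p = limn (series (fun k => `|x k| `^ p)).
Proof. by apply/esym/cvg_lim => //; exact: lp_norm_cvg. Qed.

Lemma lp_coord_le x n : `|x n| <= `|x|.
Proof.
rewrite leNgt; apply/negP => xn.
have := gt0_ltr_powR p0 (normr_ge0 x : `|x| \is Num.nneg)
  (normr_ge0 (x n) : `|x n| \is Num.nneg) xn.
apply/negP; rewrite -leNgt lp_norm_powR.
have nd : nondecreasing_seq (series (fun k => `|x k| `^ p)).
  by apply: nondecreasing_series => k _ _; exact: powR_ge0.
have := nondecreasing_cvgn_le nd (cvgP _ (@lp_norm_cvg _ _ _ x)) n.+1.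
apply: le_trans.
by rewrite /series/= big_nat_recr//= lerDr sumr_ge0// => k _; exact: powR_ge0.
Qed.

Lemma lp_dominated_mem (f : R^nat) g : (forall n, `|f n| <= `|g n|) ->
  exists x : lp p1, x = f :> R^nat.
Proof.
move=> fg.
have mf : f \in Lfun (@counting nat R) p%:E.
  apply: (lp_mem p1); apply: series_le_cvg (cvgP _ (@lp_norm_cvg _ _ _ g)) => n;
    rewrite ?powR_ge0//.
  by apply: ge0_ler_powR; rewrite ?nnegrE// ?(ltW p0).
by exists (Lfun_Sub (lt1_le1E p1) mf); exact: Lfun_valP.
Qed.

(** Tannery's theorem applied to [|f t n - l n| `^ p], which is dominated by
[(2 * g n) `^ p]. *)
Lemma lp_dominated_cvg {T} {F : set_system T} {FF : ProperFilter F}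
    (f : T -> lp p1) (l : R^nat) g :
  (\forall t \near F, forall n, `|f t n| <= g n) ->
  (forall n, f t n @[t --> F] --> l n) ->
  exists2 x : lp p1, x = l :> R^nat & f @ F --> x.
Proof.
move=> fg fl.
have lg n : `|l n| <= g n.
  apply: (cvgr_to_le (cvg_norm (fl n))).
  by apply: filterS fg => t; exact.
have [x xl] : exists x : lp p1, x = l :> R^nat.
  by apply: (@lp_dominated_mem _ g) => n; rewrite (le_trans (lg n))// ler_norm.
exists x => //; rewrite -subr_cvg0; apply/norm_cvg0P.
have normp0 : (fun t => `|f t - x| `^ p) @ F --> 0.
  have -> : (fun t => `|f t - x| `^ p) =
      (fun t => limn (series (fun n => `|f t n - x n| `^ p))).
    by apply/funext => t; rewrite lp_norm_powR.
  have -> : 0 = limn (series (fun _ : nat => 0 : R)).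
    have -> : series (fun _ : nat => 0 : R) = cst 0.
      by apply/funext => n; rewrite /series/= big1_eq.
    by apply/esym/cvg_lim => //; exact: cvg_cst.
  apply: (@dominated_cvg_series _ _ _ _ _ _
    (fun n => `|((2 : R) *: g) n| `^ p)).
  - apply: filterS fg => t ft n; rewrite ger0_norm ?powR_ge0//.
    have g0 : 0 <= g n by exact: le_trans (ft n).
    apply: ge0_ler_powR; rewrite ?nnegrE ?(ltW p0)//.
    rewrite (le_trans (ler_normB _ _))// xl -[((2 : R) *: g) n]/(2 * g n).
    rewrite [leRHS]ger0_norm ?mulr_ge0//.
    by have := ft n; have := lg n; lra.
  - exact: cvgP (@lp_norm_cvg _ _ _ _).
  - move=> n; apply: cvg_norm_powR0 => //.
    by rewrite xl; apply/subr_cvg0; exact: fl.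
have : (fun t => `| `|f t - x| `^ p| `^ p^-1) @ F --> 0.
  by apply: cvg_norm_powR0 => //; rewrite invr_gt0.
apply: cvg_trans; apply: near_eq_cvg; apply: nearW => t.
by rewrite ger0_norm ?powR_ge0// -powRrM mulfV ?gt_eqF// powRr1.
Qed.

Lemma lp_abs_mem x : exists y : lp p1, y = (fun n => `|x n|) :> R^nat.
Proof.
by apply: (@lp_dominated_mem _ x) => n; rewrite normr_id.
Qed.

End lp_theory.

(** * The derivative of powers of the norm *)

Section norm_derivative.
Context {R : realType} {p : R} {p1 : 1 < p}.
Implicit Types x v : lp p1.

Let p0 : 0 < p. Proof. exact: lt_trans p1. Qed.

Lemma dnbhs0_unit : \forall h \near (0 : R)^', h != 0 /\ `|h| <= 1.
Proof.
near=> h; split; near: h; [exact: nbhs_dnbhs_neq|exact: dnbhs0_le].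
Unshelve. all: by end_near. Qed.

Lemma abs_lp_sum x v :
  exists y : lp p1, y = (fun n => `|x n| + `|v n|) :> R^nat.
Proof.
have [a aE] := lp_abs_mem x; have [b bE] := lp_abs_mem v.
by exists (a + b); apply/funext => n; rewrite -[LHS]/(a n + b n) aE bE.
Qed.

(** Term by term differentiation: the derivative of [|x n| `^ p] is
[p * v n * spowR (p - 1) (x n) = p * ratio_seq x v n * |x n| `^ p], the last
expression being correct also when [x n = 0] because [spowR] vanishes there. *)
Lemma is_derive_lp_norm_powR x v :
  cvgn (series (fun i => ratio_seq x v i * `|x i| `^ p)) ->
  is_derive x v (fun y : lp p1 => `|y| `^ p)
    (p * limn (series (fun i => ratio_seq x v i * `|x i| `^ p))).
Proof.
move=> cw; apply/is_deriveP; set S := series _.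
pose F (h : R) (n : nat) := h^-1 * (`|h * v n + x n| `^ p - `|x n| `^ p).
have FE : (fun h : R => limn (series (F h))) =
    (fun h : R => h^-1 *: (`|h *: v + x| `^ p - `|x| `^ p)).
  apply/funext => h; apply/cvg_lim => //.
  have -> : series (F h) = (fun n => h^-1 *
      (series (fun k => `|(h *: v + x) k| `^ p) n
       - series (fun k => `|x k| `^ p) n)).
    by apply/funext => n; rewrite /series/= -sumrB mulr_sumr.
  by apply: cvgMl_tmp; apply: cvgB; exact: lp_norm_cvg.
have -> : p * limn S =
    limn (series (fun n => p * (ratio_seq x v n * `|x n| `^ p))).
  apply/esym/cvg_lim => //.
  have -> : series (fun n => p * (ratio_seq x v n * `|x n| `^ p)) =
      (fun n => p * S n).
    by apply/funext => n; rewrite /S /series/= mulr_sumr.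
  exact: cvgMl_tmp.
rewrite -FE.
have [y yE] := abs_lp_sum x v.
apply: (@dominated_cvg_series _ _ _ _ _ _ (fun n => p * `|y n| `^ p)).
- apply: filterS dnbhs0_unit => h [h0 h1] n; rewrite yE.
  have -> : `| `|x n| + `|v n| | = `|x n| + `|v n|.
    by rewrite ger0_norm ?addr_ge0.
  apply: (growth_rate_le (f := fun s => `|s| `^ p)
    (df := fun s => p * spowR (p - 1) s)) => //; first exact: ltW.
  - exact: ltW.
  - by move=> s; exact: is_derive_norm_powR.
  - move=> s; rewrite normrM (gtr0_norm p0) norm_spowR//.
    by rewrite subr_eq0 gt_eqF.
- have -> : series (fun n => p * `|y n| `^ p) =
      (fun n => p * series (fun n => `|y n| `^ p) n).
    by apply/funext => n; rewrite /series/= mulr_sumr.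
  by apply: is_cvgMl_tmp; exact: cvgP (@lp_norm_cvg _ _ _ y).
- move=> n; have := growth_rate_cvg (v := v n) (is_derive_norm_powR (x n) p1).
  congr (_ --> _); rewrite /ratio_seq; case: eqVneq => [->|xn0].
    by rewrite spowR0 !(mulr0, mul0r).
  by rewrite -(mulr_spowRB1 _ p0); field.
Qed.

End norm_derivative.

(** * The derivative of the duality mapping *)

Section duality_derivative.
Context {R : realType} {p q : R} {p1 : 1 < p} {q1 : 1 < q}.
Context (pq : p^-1 + q^-1 = 1).
Implicit Types x v : lp p1.

Let p0 : 0 < p. Proof. exact: lt_trans p1. Qed.
Let pm1 : 0 < p - 1. Proof. by rewrite subr_gt0. Qed.
Let pm1_neq0 : p - 1 != 0. Proof. by rewrite gt_eqF. Qed.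

Local Notation J := (J p1 q1 pq).

Definition ratio_sum x v : R :=
  limn (series (fun i => ratio_seq x v i * `|x i| `^ p)).

Lemma is_derive_lp_norm x v a : x != 0 ->
  is_derive x v (fun y : lp p1 => `|y| `^ a)
    (a * ratio_sum x v * `|x| `^ (a - p)).
Proof.
move=> x0; have N0 : 0 < `|x| by rewrite normr_gt0.
have -> : (fun y : lp p1 => `|y| `^ a) = (fun y => (`|y| `^ p) `^ (a / p)).
  by apply/funext => y; rewrite -powRrM mulrCA mulfV ?mulr1// gt_eqF.
have dN := is_derive_lp_norm_powR (ratio_seq_cvg q1 pq (x := x) (v := v)).
have dp := is_derive1_powR (a / p) (powR_gt0 p N0).
have dNp := is_derive_comp1 (f := fun y : lp p1 => `|y| `^ p) dp dN.
apply: (is_derive_eq dNp).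
rewrite -powRrM /ratio_sum.
have -> : p * (a / p - 1) = a - p by field; rewrite gt_eqF.
by field; rewrite gt_eqF.
Qed.

(** The duality mapping with gauge function [t `^ (p - 1)], i.e. the derivative
of [p^-1 * |x| `^ p]. It is defined from [J] so that its membership in [l_q]
is inherited. *)
Definition dualpow x : lp q1 := `|x| `^ (p - 2) *: J x.

Lemma dualpowE x : dualpow x = (fun n => spowR (p - 1) (x n)) :> R^nat.
Proof.
apply/funext => n; rewrite -[LHS]/(_ * J x n) JE /J_seq.
have [->|x0] := eqVneq x 0.
  by rewrite -[(0 : lp p1) n]/(0 : R) spowR0 sgr0 mulr0 mul0r mulr0.
by rewrite mulrC mulfVK// powR_eq0 normr_eq0 (negbTE x0).
Qed.

Lemma J_dualpow x : J x = `|x| `^ (2 - p) *: dualpow x.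
Proof.
rewrite /dualpow scalerA -(opprB p) powRN.
have [->|x0] := eqVneq x 0; last first.
  by rewrite mulVf ?scale1r// powR_eq0 normr_eq0 (negbTE x0).
suff -> : J 0 = 0 by rewrite scaler0.
by apply/normr0_eq0; rewrite norm_J normr0.
Qed.

Lemma J_coord x n : J x n = `|x| `^ (2 - p) * spowR (p - 1) (x n).
Proof. by rewrite J_dualpow -[LHS]/(_ * dualpow x n) dualpowE. Qed.

Lemma JZ a x : J (a *: x) = a *: J x.
Proof.
apply/lp_eqP => n; rewrite -[RHS]/(a * J x n) !J_coord normrZ powRM//.
rewrite -[(a *: x) n]/(a * x n) spowRM.
have [->|a0] := eqVneq a 0; first by rewrite spowR0 !(mul0r, mulr0).
suff aE : `|a| `^ (2 - p) * spowR (p - 1) a = a by rewrite -{3}aE; ring.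
rewrite /spowR mulrA -powRD ?normr_eq0 ?a0 ?implybT//.
have -> : 2 - p + (p - 1) = 1 by ring.
by rewrite powRr1// mulrC -numEsg.
Qed.

Lemma J_deriv_formulaE x v n : J_deriv_formula p1 q1 pq x v n =
  J x n * ((p - 1) * ratio_seq x v n - (p - 2) * ratio_sum x v / `|x| `^ p).
Proof.
rewrite /J_deriv_formula infdiagB rowmul_infdiag -lp_norm_powR; congr (_ * _).
by rewrite -/(ratio_sum x v) -[LHS]/(_ * _ - _ * 1) mulr1.
Qed.

(** The common core of both ranges of [p]: the product rule, once the entrywise
quotients of [dualpow] are dominated in [l_q]. Where [x n = 0] the formula has
entry 0, and this is the limit of the quotients if [v n = 0] or if the
derivative of [spowR (p - 1)] at 0 is 0, that is, [2 < p]. *)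
Lemma is_derive_J x v (g : lp q1) : x != 0 ->
  (\forall h \near (0 : R)^', forall n,
    `|h^-1 * (spowR (p - 1) (h * v n + x n) - spowR (p - 1) (x n))| <= g n) ->
  (forall n, x n = 0 -> v n = 0 \/ 2 < p) ->
  exists2 d : lp q1, d = J_deriv_formula p1 q1 pq x v :> R^nat
    & is_derive x v J d.
Proof.
move=> x0 dom supp.
pose l n := (p - 1) * ratio_seq x v n * spowR (p - 1) (x n).
have [|n|d dE dd] := @lp_dominated_cvg R q q1 R (0 : R)^' _
    (fun h : R => h^-1 *: (dualpow (h *: v + x) - dualpow x)) l g.
- apply: filterS dom => h gh n; have := gh n; congr (_ <= _); congr `|_|.
  rewrite -[RHS]/(_ * (dualpow _ n - dualpow _ n)) !dualpowE.
  by [].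
- have -> : (fun h => (h^-1 *: (dualpow (h *: v + x) - dualpow x)) n) =
      (fun h => h^-1 * (spowR (p - 1) (h * v n + x n) - spowR (p - 1) (x n))).
    apply/funext => h.
    by rewrite -[LHS]/(_ * (dualpow _ n - dualpow _ n)) !dualpowE.
  rewrite /l /ratio_seq; have [xn0|xn0] := eqVneq (x n) 0.
    rewrite mulr0 mul0r; have [vn0|p2] := supp n xn0.
      apply: cvg_near_cst; apply: nearW => h.
      by rewrite vn0 xn0 mulr0 add0r subrr mulr0.
    have dp : is_derive (x n) 1 (spowR (p - 1))
        ((p - 1) * `|x n| `^ (p - 1 - 1)).
      by apply: is_derive_spowR; apply/orP; right; lra.
    have := growth_rate_cvg (v := v n) dp; congr (_ --> _).
    by rewrite xn0 normr0 powR0 ?mulr0//; lra.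
  have dp : is_derive (x n) 1 (spowR (p - 1)) ((p - 1) * `|x n| `^ (p - 1 - 1)).
    by apply: is_derive_spowR; rewrite xn0.
  have := growth_rate_cvg (v := v n) dp; congr (_ --> _).
  rewrite /spowR -(mulr_powRB1 (normr_ge0 (x n)) pm1).
  have -> : `|x n| * `|x n| `^ (p - 1 - 1) * Num.sg (x n)
      = x n * `|x n| `^ (p - 1 - 1).
    by rewrite mulrAC [_ * Num.sg _]mulrC -numEsg.
  by field.
have dP : is_derive x v dualpow d by apply/is_deriveP.
have dJ := is_derive_scale (is_derive_lp_norm v (2 - p) x0) dP.
have JE' : J = (fun y => `|y| `^ (2 - p) *: dualpow y).
  by apply/funext => y; exact: J_dualpow.
eexists; last by rewrite JE'; exact: dJ.
apply/funext => n; rewrite J_deriv_formulaE J_coord.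
rewrite -[LHS]/(_ * d n + _ * dualpow x n) dualpowE dE /l.
have -> : `|x| `^ (2 - p - p) = `|x| `^ (2 - p) / `|x| `^ p.
  by rewrite powRB// normr_eq0 x0 implybT.
by ring.
Qed.

Lemma is_derive_J_gt2 x v : 2 < p -> x != 0 ->
  exists2 d : lp q1, d = J_deriv_formula p1 q1 pq x v :> R^nat
    & is_derive x v J d.
Proof.
move=> p2 x0; have [y yE] := abs_lp_sum x v.
apply: (is_derive_J (g := (p - 1) *: dualpow y)) => //; last by right.
apply: filterS dnbhs0_unit => h [h0 h1] n.
rewrite -[leRHS]/(_ * dualpow y n) dualpowE yE.
have -> : spowR (p - 1) (`|x n| + `|v n|) = (`|x n| + `|v n|) `^ (p - 1).
  by rewrite ger0_spowR ?addr_ge0.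
apply: (growth_rate_le (f := spowR (p - 1))
  (df := fun s => (p - 1) * `|s| `^ (p - 1 - 1))) => //.
- lra.
- exact: ltW.
- by move=> s; apply: is_derive_spowR; apply/orP; right; lra.
- by move=> s; rewrite normrM (gtr0_norm pm1) (ger0_norm (powR_ge0 _ _)).
Qed.

Lemma is_derive_J_lt2 x v : p < 2 -> x != 0 ->
  nzset v `<=` nzset x -> bounded_fun (ratio_seq x v) ->
  exists2 d : lp q1, d = J_deriv_formula p1 q1 pq x v :> R^nat
    & is_derive x v J d.
Proof.
move=> p2 x0 vx [M0 [_ /(_ (Num.max M0 0 + 1))]].
rewrite (le_lt_trans (_ : M0 <= Num.max M0 0)) ?ltrDl ?le_max ?lexx//=.
move=> /(_ isT).
set M := _ + 1 => ratioM.
have M_gt0 : 0 < M by rewrite /M ltr_wpDl// le_max lexx orbT.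
have supp n : x n = 0 -> v n = 0.
  move=> xn0; apply/eqP/negPn/negP => vn0.
  by have := vx _ vn0; rewrite /nzset/= xn0 eqxx.
have [y yE] := lp_abs_mem x.
apply: (is_derive_J (g := M *: dualpow y)) => //; last by move=> n /supp; left.
near=> h => n.
have h0 : h != 0 by near: h; exact: nbhs_dnbhs_neq.
have hM : `|h| <= M^-1 by near: h; apply: dnbhs0_le; rewrite invr_gt0.
rewrite -[leRHS]/(_ * dualpow y n) dualpowE yE.
have -> : spowR (p - 1) `|x n| = `|x n| `^ (p - 1) by rewrite ger0_spowR.
have [xn0|xn0] := eqVneq (x n) 0.
  rewrite (supp n xn0) xn0 mulr0 add0r subrr mulr0 normr0.
  by rewrite mulr_ge0 ?powR_ge0// ltW.
have lM : `|v n / x n| <= M.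
  by have := ratioM n I; rewrite /ratio_seq (negbTE xn0).
(* The increment is relative to [x n], so [spowR (p - 1) (x n)] factors out. *)
have -> : h * v n + x n = (1 + h * (v n / x n)) * x n by field.
rewrite spowRM -{2}[spowR _ (x n)]mul1r -mulrBl normrM [X in _ * X]normrM.
rewrite (norm_spowR (x n) pm1_neq0).
rewrite mulrA ler_wpM2r ?powR_ge0// normfV ler_pdivrMl ?normr_gt0//.
have hl : `|h * (v n / x n)| <= 1.
  by rewrite normrM -(mulVf (lt0r_neq0 M_gt0)) ler_pM.
apply: le_trans (norm_spowR1D_sub1_le _ hl) _; first by rewrite pm1/=; lra.
by rewrite normrM ler_wpM2l.
Unshelve. all: by end_near. Qed.

(** If the quotients of [J] had a limit, their [n]-th entries would converge,
and so would their products with [|x + h v| `^ (p - 2) * |h| `^ (2 - p)], to 0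
since [p < 2]. But these products have the constant absolute value
[|v n| `^ (p - 1)]. *)
Lemma not_derivable_J x v n : p < 2 -> x != 0 -> x n = 0 -> v n != 0 ->
  ~ derivable J x v.
Proof.
move=> p2 x0 xn0 vn0 /derivableP/is_deriveP; set d := 'D_v _ _ => dJ.
have dJn : h^-1 * J (h *: v + x) n @[h --> (0 : R)^'] --> d n.
  apply/subr_cvg0/norm_cvg0P.
  have /subr_cvg0/norm_cvg0P d0 := dJ.
  apply: squeeze_cvgr (cvg_cst 0) d0; apply: nearW => h.
  rewrite normr_ge0/=.
  have := lp_coord_le (h^-1 *: (J (h *: v + x) - J x) - d) n.
  rewrite -[X in `|X| <= _]/(h^-1 * (J (h *: v + x) n - J x n) - d n).
  by rewrite [J x n]J_coord xn0 spowR0 mulr0 subr0.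
have nJ := is_derive_cvg (is_derive_lp_norm v (p - 2) x0).
have h0 : (fun h : R => `|h| `^ (2 - p)) @ 0^' --> (0 : R).
  apply: (@cvg_norm_powR0 _ _ _ _ id); [lra|exact: nbhs_dnbhs].
have c0 : `|h^-1 * J (h *: v + x) n * `|h *: v + x| `^ (p - 2)
      * `|h| `^ (2 - p)| @[h --> (0 : R)^'] --> (0 : R).
  have := cvg_norm (cvgM (cvgM dJn nJ) h0); rewrite mulr0 normr0; exact.
have c1 : (fun _ : R => `|v n| `^ (p - 1)) @ (0 : R)^' --> (0 : R).
  apply: cvg_trans c0; apply: near_eq_cvg; near=> h.
  have hn0 : h != 0 by near: h; exact: nbhs_dnbhs_neq.
  have y0 : `|h *: v + x| != 0.
    rewrite normr_eq0; apply/eqP => /(congr1 (fun f : lp p1 => f n)).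
    rewrite -[LHS]/(h * v n + x n) xn0 addr0 => /eqP.
    by rewrite mulf_eq0 (negbTE hn0) (negbTE vn0).
  rewrite -[LHS]/`|h^-1 * J (h *: v + x) n * `|h *: v + x| `^ (p - 2)
    * `|h| `^ (2 - p)|.
  rewrite J_coord -(opprB p) !powRN -[(h *: v + x) n]/(h * v n + x n) xn0 addr0.
  rewrite spowRM 4!normrM [`|_ * spowR _ _|]normrM !norm_spowR// !normfV.
  rewrite !(ger0_norm (powR_ge0 _ _)).
  set Y := _ `^ (p - 2); have Y0 : Y != 0 by rewrite powR_eq0 (negbTE y0).
  have -> : `|h| `^ (p - 1) = `|h| * `|h| `^ (p - 2).
    rewrite -{2}(powRr1 (normr_ge0 h)) -powRD ?normr_eq0 ?hn0 ?implybT//.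
    by congr (_ `^ _); ring.
  field; rewrite Y0 normr_eq0 hn0/= powR_eq0 normr_eq0 (negbTE hn0)//.
have /eqP : `|v n| `^ (p - 1) = 0.
  by apply: (cvg_unique (@Rhausdorff R) _ c1); exact: cvg_cst.
by rewrite powR_eq0 normr_eq0 (negbTE vn0).
Unshelve. all: by end_near. Qed.

Lemma is_derive_J0 v : is_derive 0 v J (J v).
Proof.
apply/is_deriveP; apply: cvg_near_cst; near=> h.
have h0 : h != 0 by near: h; exact: nbhs_dnbhs_neq.
have -> : J 0 = 0 by rewrite -(scale0r 0) JZ scale0r.
by rewrite addr0 subr0 JZ scalerA mulVf// scale1r.
Unshelve. all: by end_near. Qed.

Lemma is_derive_J_self x : is_derive x x J (J x).
Proof.
apply/is_deriveP; apply: cvg_near_cst; near=> h.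
have h0 : h != 0 by near: h; exact: nbhs_dnbhs_neq.
rewrite -{2}[x]scale1r -scalerDl JZ -{2}[J x]scale1r -scalerBl addrK.
by rewrite scalerA mulVf// scale1r.
Unshelve. all: by end_near. Qed.

End duality_derivative.

(** * Directions and points with special supports *)

Section special_cases.
Context {R : realType}.

Lemma limn_series_single (u : R^nat) m :
  (forall n, n != m -> u n = 0) -> limn (series u) = u m.
Proof.
move=> um; apply: cvg_lim => //; apply: cvg_near_cst; near=> n.
have mn : (m < n)%N by near: n; exact: nbhs_infty_gt.
rewrite /series/= (bigD1_seq m) ?mem_index_iota ?iota_uniq//=.
by rewrite big1 ?addr0.
Unshelve. all: by end_near. Qed.

Lemma nzset_card1 (x : R^nat) : (nzset x #= `I_1)%card ->
  exists2 m, x m != 0 & forall n, n != m -> x n = 0.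
Proof.
rewrite card_eq_sym => /ppcard_eqP/unsquash f.
have f0 : nzset x (f 0%N) by exact: funS.
exists (f 0%N) => // n nf; apply/eqP/negPn/negP => xn.
have [[|k]//= _ fn] : (f @` `I_1) n by rewrite image_eq.
by rewrite -fn eqxx in nf.
Qed.

Lemma bounded_fun_finite_nzset (u : R^nat) :
  finite_set (nzset u) -> bounded_fun u.
Proof.
move=> /finite_seqP[s sE].
have uM n : `|u n| <= \sum_(i <- s) `|u i|.
  have [->|un0] := eqVneq (u n) 0; first by rewrite normr0 sumr_ge0.
  have ns : n \in s by have : nzset u n by []; rewrite sE.
  by rewrite (big_rem n)//= lerDl sumr_ge0.
exists (\sum_(i <- s) `|u i|); split; first exact: num_real.
by move=> M MM n _; rewrite /= (le_trans (uM n))// ltW.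
Qed.

Context {p q : R} {p1 : 1 < p} {q1 : 1 < q} (pq : p^-1 + q^-1 = 1).
Implicit Types x v : lp p1.

Local Notation J := (J p1 q1 pq).

Lemma lp_norm_single x m : (forall n, n != m -> x n = 0) -> `|x| = `|x m|.
Proof.
move=> xm; have p0 : 0 < p := lt_trans ltr01 p1.
apply: (powR_injective p0); rewrite ?nnegrE//= lp_norm_powR.
rewrite (@limn_series_single _ m)// => n /xm ->.
by rewrite normr0 powR0// gt_eqF.
Qed.

Lemma J_single x m : x m != 0 -> (forall n, n != m -> x n = 0) ->
  J x = x :> R^nat.
Proof.
move=> xm0 xm; apply/funext => n; rewrite J_coord (lp_norm_single xm).
have [->|/xm ->] := eqVneq n m; last by rewrite spowR0 mulr0.
rewrite /spowR mulrA -powRD ?normr_eq0 ?xm0 ?implybT//.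
have -> : 2 - p + (p - 1) = 1 by ring.
by rewrite powRr1// mulrC -numEsg.
Qed.

(** The quotient of sums in the formula is [ratio_seq x v m], so the diagonal
entry at [m] is [(p - 1) - (p - 2) = 1] times it; the entries of the second
matrix off [m] are annihilated by [J x]. *)
Lemma J_deriv_formula_single x v m : x m != 0 ->
  (forall n, n != m -> x n = 0) ->
  J_deriv_formula p1 q1 pq x v = rowmul (J x)
    (infdiag (fun n => if n == m then ratio_seq x v m else 0)).
Proof.
move=> xm0 xm; rewrite rowmul_infdiag; apply/funext => n.
rewrite J_deriv_formulaE (J_single xm0 xm).
have [->|/xm ->] := eqVneq n m; last by rewrite !mul0r.
congr (_ * _); rewrite /ratio_sum (lp_norm_single xm).
rewrite (@limn_series_single _ m)// => [|k /xm xk0]; last first.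
  by rewrite /ratio_seq xk0 eqxx mul0r.
rewrite mulrA mulfK; first by ring.
by rewrite powR_eq0 normr_eq0 (negbTE xm0).
Qed.

Lemma J_deriv_formula_disjoint x v : (forall n, v n * x n = 0) ->
  J_deriv_formula p1 q1 pq x v = fun=> 0.
Proof.
move=> vx; have r0 n : ratio_seq x v n = 0.
  rewrite /ratio_seq; have [//|xn0] := eqVneq (x n) 0.
  have /eqP := vx n; rewrite mulf_eq0 (negbTE xn0) orbF => /eqP ->.
  by rewrite mul0r.
apply/funext => n; rewrite J_deriv_formulaE r0 /ratio_sum.
by rewrite (@limn_series_single _ 0) => [|k _];
  rewrite r0 mul0r// !(mulr0, mul0r) subrr mulr0.
Qed.

End special_cases.

Theorem theorem3p2 (R : realType) (p q : R) (p1 : 1 < p) (q1 : 1 < q)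
    (pq : p^-1 + q^-1 = 1) :
  [/\ (* (i) *)
      gateaux_differentiable (J p1 q1 pq) 0 /\
      (forall v : lp p1, v != 0 -> 'D_v (J p1 q1 pq) 0 = J p1 q1 pq v),
      (* (ii) *)
      2 < p -> forall xbar : lp p1, xbar != 0 ->
        gateaux_differentiable (J p1 q1 pq) xbar /\
        (forall v : lp p1, v != 0 ->
          [/\ 'D_v (J p1 q1 pq) xbar = J_deriv_formula p1 q1 pq xbar v :> R^nat,
              (forall m : nat, (nzset xbar #= `I_1)%card -> xbar m != 0 ->
                let Lambda :=
                  infdiag (fun n => if n == m then ratio_seq xbar v m else 0) in
                'D_v (J p1 q1 pq) xbar = rowmul (J p1 q1 pq xbar) Lambda :> R^nat
                /\ rowmul (J p1 q1 pq xbar) Lambda = rowmul xbar Lambda) &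
              ((forall n, v n * xbar n = 0) -> 'D_v (J p1 q1 pq) xbar = 0)]),
      (* (iii) *)
      p < 2 -> forall xbar v : lp p1, xbar != 0 -> v != 0 ->
        [/\ ~ nzset v `<=` nzset xbar -> ~ derivable (J p1 q1 pq) xbar v,
            nzset v `<=` nzset xbar -> bounded_fun (ratio_seq xbar v) ->
              derivable (J p1 q1 pq) xbar v /\
              'D_v (J p1 q1 pq) xbar = J_deriv_formula p1 q1 pq xbar v :> R^nat,
            nzset v `<=` nzset xbar ->
              nzset v !=set0 -> finite_set (nzset v) ->
              derivable (J p1 q1 pq) xbar v /\
              'D_v (J p1 q1 pq) xbar = J_deriv_formula p1 q1 pq xbar v :> R^nat &
            nzset v `<=` nzset xbar ->
              nzset xbar !=set0 -> finite_set (nzset xbar) ->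
              derivable (J p1 q1 pq) xbar v /\
              'D_v (J p1 q1 pq) xbar = J_deriv_formula p1 q1 pq xbar v :> R^nat]
    & (* (iv) *)
      (forall xbar : lp p1, xbar != 0 ->
        derivable (J p1 q1 pq) xbar xbar /\
        'D_xbar (J p1 q1 pq) xbar = J p1 q1 pq xbar) /\
      (forall xbar : lp p1, (nzset xbar #= `I_1)%card ->
        'D_xbar (J p1 q1 pq) xbar = xbar :> R^nat)].
Proof.
split.
- split=> [v _|v _]; first by have [] := is_derive_J0 pq v.
  by have [] := is_derive_J0 pq v.
- move=> p2 x x0; split=> [v _|v _].
    by have [d _ [dJ _]] := is_derive_J_gt2 pq v p2 x0.
  have [d dE [_ DJ]] := is_derive_J_gt2 pq v p2 x0.
  rewrite DJ; split=> // [m x1 xm0 Lambda|vx].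
    have [m' _ xm'] := nzset_card1 x1.
    have mm : m = m' by apply/eqP/negPn/negP => /xm' xm; rewrite xm eqxx in xm0.
    rewrite -mm in xm'.
    have J_x := J_single pq xm0 xm'.
    by rewrite dE (J_deriv_formula_single _ _ xm0 xm') J_x.
  apply/lp_eqP => n; rewrite dE J_deriv_formula_disjoint//.
- move=> p2 x v x0 _.
  have bnd : nzset v `<=` nzset x -> bounded_fun (ratio_seq x v) ->
      derivable (J p1 q1 pq) x v /\
      'D_v (J p1 q1 pq) x = J_deriv_formula p1 q1 pq x v :> R^nat.
    move=> vx bv; have [d dE [dJ ->]] := is_derive_J_lt2 pq p2 x0 vx bv.
    by split.
  have fin : nzset v `<=` nzset x -> finite_set (nzset v) ->
      derivable (J p1 q1 pq) x v /\
      'D_v (J p1 q1 pq) x = J_deriv_formula p1 q1 pq x v :> R^nat.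
    move=> vx fv; apply: bnd => //; apply: bounded_fun_finite_nzset.
    apply: sub_finite_set fv => n; rewrite /nzset/= /ratio_seq.
    have [_|_] := eqVneq (x n) 0; first by rewrite eqxx.
    by rewrite mulf_eq0 negb_or => /andP[].
  split=> //.
    move=> /existsNP[n /not_implyP[vn0 /negP/negPn/eqP xn0]].
    exact: not_derivable_J p2 x0 xn0 vn0.
    by move=> vx _; exact: fin.
  by move=> vx _ fx; apply: fin => //; exact: sub_finite_set fx.
- split=> [y _|y /nzset_card1[m ym0 ym]].
    by have [dJ DJ] := is_derive_J_self pq y.
  by have [_ ->] := is_derive_J_self pq y; exact: J_single ym0 ym.
Qed.
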